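(* Assume that $T = \Delta(T)^2$ for every finite (non-abelian) simple transitive permutation group $T$ (the conjecture of Larsen, Shalev and Tiep). Let $G \leqslant {\rm Sym}(\Omega)$ be a finite primitive permutation group with socle $N$ and $|\Omega| \geqslant 3$. Then $N = \Delta(N)^2$.
   Context: For a finite transitive permutation group $X\leqslant {\rm Sym}(\Omega)$ with $|\Omega|\geqslant 2$, an element is a derangement if it has no fixed points on $\Omega$; $\Delta(X)$ is the set of derangements in $X$ and $\Delta(X)^2 = \{xy : x,y\in\Delta(X)\}$. The socle of $G$ is the product of its minimal normal subgroups, and $\Delta(N)$ is the set of derangements contained in $N$ with respect to the action of $N$ on $\Omega$. *)

(* Defs.v *)
From mathcomp Require Import all_boot all_fingroup all_solvable.

Set Implicit Arguments.
Unset Strict Implicit.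
Unset Printing Implicit Defensive.

Local Open Scope group_scope.

Definition derangements (Omega : finType) (X : {set {perm Omega}}) :
    {set {perm Omega}} :=
  [set x in X | [forall w : Omega, x w != w]].

(* The product is the join in the lattice of subgroups; as the factors are
   normal in [G], it coincides with their set-theoretic product.             *)
Definition socle (gT : finGroupType) (G : {group gT}) : {group gT} :=
  (\prod_(M : {group gT} | [min M of H | (H :!=: 1) && (H <| G)]) M)%G.

(* Main.v *)
(* Let N be the socle.  If G has an abelian minimal normal subgroup M, then M is
   transitive and N centralises it, so every nontrivial element of N is a
   derangement.  Otherwise let H be a maximal subgroup of N containing a point
   stabiliser: the derangements of N on the cosets of H are derangements on
   Omega.  Some simple factor T of N is not contained in H; let C = C_N(T), so
   that N = TC.  If C <= H, then the action of T on T / (T :&: H) reduces the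
   claim to the conjecture for T.  Otherwise TH = CH = N, which makes T :&: H
   and C :&: H normal in N; hence T :&: H = 1 and |C : C :&: H| = |T| > 2, so
   T and C \ H contain enough derangements to write every element of TC as a
   product of two of them. *)

Require Import Defs.
From mathcomp Require Import all_boot all_fingroup all_solvable.

Set Implicit Arguments.
Unset Strict Implicit.

Local Open Scope group_scope.

Definition LST_conjecture : Prop :=
  forall (Gamma : finType) (T : {group {perm Gamma}}),
    1 < #|Gamma| -> simple T -> ~~ abelian T ->
    [transitive T, on [set: Gamma] | 'P] ->
    T :=: derangements T * derangements T.

(* The elements of [X] acting without fixed points on the cosets of [H] in [X]. *)
Definition coset_derangements (gT : finGroupType) (X H : {set gT}) : {set gT} :=
  [set x in X | [forall y in X, x ^ y \notin H]].

(** * Derangements in coset actions, for an abstract group *)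

Section CosetDerangements.

Variable gT : finGroupType.
Implicit Types C H K N T : {group gT}.

Lemma coset_derangementsP (X H : {set gT}) x :
  reflect (x \in X /\ forall y, y \in X -> x ^ y \notin H)
          (x \in coset_derangements X H).
Proof.
by rewrite inE; apply: (iffP andP) => -[Xx] => [/forall_inP | /forall_inP].
Qed.

Lemma coset_derangementsS (X H1 H2 : {set gT}) :
  H1 \subset H2 -> coset_derangements X H2 \subset coset_derangements X H1.
Proof.
move=> sH; apply/subsetP=> x /coset_derangementsP[Xx dx].
apply/coset_derangementsP; split=> // y /dx.
by apply: contra; apply: (subsetP sH).
Qed.

(** The kernel of the action of [T] on the right cosets of [H] is trivial: otherwise it would be
    [T], which would then fix the coset [H]. So [T] is isomorphic to a transitive permutation group,
    and factorisations pull back. *)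
Lemma LST_coset_derangements T H :
    LST_conjecture -> simple T -> ~~ abelian T -> H \proper T ->
  T \subset coset_derangements T H * coset_derangements T H.
Proof.
move=> LST simT nabT ltHT; have [sHT not_sTH] := andP ltHT.
have HrT : (H : {set gT}) \in rcosets H T.
  by apply/rcosetsP; exists 1; rewrite ?group1 ?mulg1.
(* The cosets form a type of their own, since [LST] wants transitivity on a full type. *)
pose Gamma : finType := {A : {set gT} | A \in rcosets H T}.
pose A0 : Gamma := Sub (H : {set gT}) HrT.
pose to := ('Rs^? : action _ Gamma)%act.
have domT: T \subset subact_dom (fun A => A \in rcosets H T) 'Rs.
  rewrite /subact_dom; have -> : [set A | A \in rcosets H T] = rcosets H T.
    by apply/setP=> A; rewrite inE.
  exact: atrans_acts (transRs_rcosets H T).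
have toE (A : Gamma) x : x \in T -> val (to A x) = val A :* x.
  by move=> Tx; rewrite val_subact (subsetP domT) ?Tx /= ?rcosetE.
pose f := [morphism of restrm domT (actperm to)].
have fE x (A : Gamma) : x \in T -> val (f x A) = val A :* x.
  by move=> Tx; rewrite /= /restrm actpermE toE.
have trT: [transitive f @* T, on [set: Gamma] | 'P].
  apply/imsetP; exists A0 => //; apply/eqP; rewrite eq_sym eqEsubset subsetT /=.
  apply/subsetP=> A _; have /rcosetsP[x Tx defA] := valP A.
  apply/imsetP; exists (f x); first by rewrite mem_morphim.
  by apply: val_inj; rewrite /= apermE fE.
have injf: 'injm f.
  have /simpleP[_ simpT] := simT.
  have [ker1 | kerT] := simpT _ (ker_normal f).
    by rewrite ker1.
  case/negP: not_sTH.
  apply/subsetP=> x Tx; have: x \in 'ker f by rewrite kerT.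
  move/mker=> fx1.
  have := fE x A0 Tx; rewrite fx1 perm1 /= => ->.
  exact: rcoset_refl.
have cardG: 1 < #|Gamma|.
  by rewrite card_sig -/(#|T : H|) indexg_gt1.
have isoT: T \isog f @* T by rewrite sub_isog.
have simfT: simple (f @* T) by rewrite -(isog_simple isoT).
have nabfT: ~~ abelian (f @* T) by rewrite -(isog_abelian isoT).
have derP x : x \in T -> f x \in derangements (f @* T) ->
    x \in coset_derangements T H.
  move=> Tx; rewrite inE => /andP[_ /forallP dx].
  apply/coset_derangementsP; split=> // y Ty; apply/negP=> Hxy.
  (* The coset [H :* y^-1] is fixed by [x] exactly when [x ^ y] lies in [H]. *)
  have yT: H :* y^-1 \in rcosets H T.
    by apply/rcosetsP; exists y^-1; rewrite ?groupV.
  case/eqP: (dx (Sub (H :* y^-1) yT : Gamma)); apply: val_inj; rewrite fE //=.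
  by rewrite -rcosetM; apply: rcoset_eqP; rewrite mem_rcoset invgK -mulgA -conjgE.
apply/subsetP=> x Tx; have := LST _ (f @* T)%G cardG simfT nabfT trT.
move/setP/(_ (f x)); rewrite /= mem_morphim //.
move/esym/mulsgP=> [fa fb Da Db fab].
have [/morphimP[a Ta _ ea] /morphimP[b Tb _ eb]] : fa \in f @* T /\ fb \in f @* T.
  by split; [move: Da | move: Db]; rewrite inE => /andP[].
apply/mulsgP; exists a b; rewrite ?derP -?ea -?eb //.
by apply: (injmP injf); rewrite ?groupM // morphM // -ea -eb.
Qed.

(** Conjugating [t * c] by [u * d] gives [t ^ u * c ^ d] with [c ^ d] in [H], so only the
    [T]-component decides membership in [H]. The [C]-component can thus be absorbed into the second
    factor. *)
Lemma coset_derangements_factor_sub N T C H :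
    LST_conjecture -> simple T -> ~~ abelian T -> T \* C = N ->
    ~~ (T \subset H) -> C \subset H ->
  N \subset coset_derangements N H * coset_derangements N H.
Proof.
move=> LST simT nabT /cprodP[_ defN cTC] not_sTH sCH.
have sTN: T \subset N by rewrite -defN mulG_subl.
have ltHT: T :&: H \proper T by rewrite properE subsetIl subsetI subxx.
have DT t c : t \in coset_derangements T (T :&: H) -> c \in C ->
    t * c \in coset_derangements N H.
  case/coset_derangementsP=> Tt dt Cc; have cTc := subsetP cTC c Cc.
  have Nc: c \in N by rewrite -defN (subsetP (mulG_subr T C)).
  apply/coset_derangementsP; split; first by rewrite groupM // (subsetP sTN).
  move=> y; rewrite -{1}defN => /mulsgP[u d Tu Cd ->]; have cTd := subsetP cTC d Cd.
  have Ttu: t ^ u \in T by rewrite groupJ.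
  have cu: c ^ u = c by rewrite conjgE (centP cTc) ?mulKg.
  have tud: (t ^ u) ^ d = t ^ u by rewrite conjgE -(centP cTd) ?mulKg.
  have Hcd: c ^ d \in H by rewrite (subsetP sCH) // (groupJ Cc Cd).
  rewrite conjgM (conjMg t c u) cu (conjMg _ c d) tud groupMr //.
  by have:= dt u Tu; rewrite inE Ttu.
apply/subsetP=> x; rewrite -{1}defN => /mulsgP[t c Tt Cc ->].
have /subsetP/(_ t Tt)/mulsgP[a b Da Db ->] :=
  LST_coset_derangements LST simT nabT ltHT.
by apply/mulsgP; exists a (b * c); rewrite ?mulgA ?DT // -[a]mulg1 DT ?group1.
Qed.

Lemma mulg_maximal_normal K H N :
  maximal H N -> K <| N -> ~~ (K \subset H) -> K * H = N.
Proof.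
case/maxgroupP=> /andP[sHN _] maxH /andP[sKN nKN] not_sKH.
rewrite -norm_joinEr ?(subset_trans sHN) //; apply: contraNeq not_sKH => neKHN.
have defKH: K <*> H = H.
  apply: (maxH (K <*> H)%G); last exact: joing_subr.
  by rewrite properEneq neKHN join_subG sKN.
by rewrite -defKH joing_subl.
Qed.

Lemma coset_derangements_factor_notsub N T C H :
    simple T -> ~~ abelian T -> T \* C = N -> maximal H N ->
    ~~ (T \subset H) -> ~~ (C \subset H) ->
  N \subset coset_derangements N H * coset_derangements N H.
Proof.
move=> simT nabT /cprodP[_ defN cCT] maxH not_sTH not_sCH.
have sTN: T \subset N by rewrite -defN mulG_subl.
have nTN: N \subset 'N(T) by rewrite -defN mul_subG ?normG // cents_norm.
have nsTN: T <| N by rewrite /normal sTN.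
have nsCN: C <| N.
  rewrite /normal -{1}defN mulG_subr -defN mul_subG ?normG //.
  by rewrite cents_norm // centsC.
have sHN: H \subset N by have /andP[] := maxgroupp maxH.
have defTH: T * H = N by exact: mulg_maximal_normal.
have defCH: C * H = N by exact: mulg_maximal_normal.
(* [B :&: H] is normalised by [H] and centralised by [A], hence normalised by [A * H = N]. *)
have capN (A B : {group gT}) :
    A * H = N -> B <| N -> A \subset 'C(B) -> B :&: H <| N.
  move=> defAH /andP[sBN nBN] cBA; rewrite /normal subIset ?sBN //=.
  rewrite -defAH mul_subG //.
    by rewrite cents_norm // centsC subIset // centsC cBA.
  by rewrite normsI ?normG // (subset_trans sHN).
have nsTHN: T :&: H <| N by apply: capN defCH nsTN cCT.
have nsCHN: C :&: H <| N by apply: capN defTH nsCN _; rewrite centsC.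
have trivTH: T :&: H = 1.
  have /simpleP[_ simpT] := simT.
  case: (simpT (T :&: H)%G) => //=.
    exact: normalS (subsetIl _ _) sTN nsTHN.
  by move/setIidPl=> sTH; rewrite sTH in not_sTH.
have gt2T: 2 < #|T|.
  rewrite ltnNge; apply: contra nabT => leT2.
  apply: cyclic_abelian; case: ltngtP leT2 => // [|T2 _]; last first.
    by apply: prime_cyclic; rewrite T2.
  by rewrite ltnS -trivg_card_le1 => /eqP-> _; apply: cyclic1.
(* Comparing the orders of [T * H] and [C * H], both equal to [N], gives
   [#|C| = #|T| * #|C :&: H|]. *)
have cardC: #|C :&: H|.*2 < #|C|.
  have eqTH := mul_cardG T H; have eqCH := mul_cardG C H.
  rewrite defTH trivTH cards1 muln1 in eqTH; rewrite defCH -eqTH in eqCH.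
  have {}eqCH: #|C| = (#|T| * #|C :&: H|)%N.
    by apply/eqP; rewrite -(eqn_pmul2r (cardG_gt0 H)) eqCH mulnAC.
  by rewrite eqCH -mul2n ltn_pmul2r ?cardG_gt0.
have Dnormal (K : {group gT}) x : K :&: H <| N -> K <| N -> x \in K ->
    x \notin H -> x \in coset_derangements N H.
  move=> nsKHN /andP[sKN nKN] Kx notHx; apply/coset_derangementsP.
  split=> [|y Ny]; first exact: subsetP Kx.
  apply: contra notHx => Hxy; have: x \in K :&: H; last by case/setIP.
  rewrite -(memJ_norm _ (subsetP (normal_norm nsKHN) y Ny)).
  by rewrite inE memJ_norm ?Kx ?(subsetP nKN).
have DT t : t \in T -> t != 1 -> t \in coset_derangements N H.
  move=> Tt nt_t; apply: (Dnormal T) => //; apply: contra nt_t => Ht.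
  by rewrite -in_set1 -[[set 1]]trivTH inE Tt.
have DC c : c \in C -> c \notin H -> c \in coset_derangements N H.
  exact: (Dnormal C).
apply/subsetP=> x; rewrite -{1}defN => /mulsgP[t c Tt Cc ->].
have Nt := subsetP sTN t Tt; have Nc := subsetP (normal_sub nsCN) c Cc.
have [Hc | notHc] := boolP (c \in H); last first.
  have [t1 | nt_t] := eqVneq t 1; last by apply/mulsgP; exists t c; [exact: DT | exact: DC | ].
  (* Two cosets of [C :&: H] do not fill [C]; an [a] outside both has [a] and [a^-1 * c] outside
     [H]. *)
  have: ~~ (C \subset (C :&: H) :|: (c *: (C :&: H))).
    apply: contraL cardC => /subset_leq_card leC; rewrite -leqNgt.
    apply: leq_trans leC (leq_trans (leq_card_setU _ _) _).
    by rewrite card_lcoset addnn.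
  case/subsetPn=> a Ca; rewrite in_setU negb_or.
  rewrite mem_lcoset !inE Ca groupM ?groupV //= => /andP[notHa notHca].
  rewrite t1 mul1g.
  apply/mulsgP; exists a (a^-1 * c); rewrite ?mulKVg //; first exact: DC.
  by apply: DC; [rewrite groupM ?groupV | rewrite -groupV invMg invgK].
(* With [c] in [H], split [t] as [a * (a^-1 * t)] with both parts nontrivial; [c] joins the second
   part harmlessly, as [C :&: H] is normal in [N]. *)
have: ~~ (T \subset [set 1; t]).
  apply: contraL gt2T => /subset_leq_card leT; rewrite -leqNgt.
  by apply: leq_trans leT _; rewrite cards2; case: (1 != t).
case/subsetPn=> a Ta; rewrite !inE negb_or.
have DTC u d : u \in T -> u != 1 -> d \in C :&: H ->
    u * d \in coset_derangements N H.
  move=> Tu nt_u; case/setIP=> Cd Hd; have Nu := subsetP sTN u Tu.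
  apply/coset_derangementsP; split=> [|y Ny].
    by rewrite groupM // (subsetP (normal_sub nsCN)).
  rewrite conjMg groupMr; last first.
    have nCHy := subsetP (normal_norm nsCHN) y Ny.
    have: d ^ y \in C :&: H by rewrite memJ_norm // inE Cd.
    by case/setIP.
  by have /coset_derangementsP[_ ->] := DT u Tu nt_u.
case/andP=> nt_a neq_at; apply/mulsgP.
exists a (a^-1 * t * c); [exact: DT | | by rewrite -mulgA mulKVg].
by apply: DTC; rewrite ?groupM ?groupV ?inE ?Cc // -eq_mulVg1.
Qed.

End CosetDerangements.

(** * Minimal normal subgroups, their simple factors, and the socle *)

Section Socle.

Variable gT : finGroupType.
Implicit Types G H M S T : {group gT}.

(** [M] is a direct product of automorphic images of one simple group. These generate [M], so one of
    them is not inside [H]; the remaining factors centralise it. *)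
Lemma minnormal_simple_factor G M H :
    minnormal M G -> ~~ abelian M -> ~~ (M \subset H) ->
  exists T : {group gT},
    [/\ simple T, ~~ abelian T, ~~ (T \subset H) & T * 'C_M(T) = M].
Proof.
move=> minM nabM not_sMH.
have [S [sSM simS [I sIA defM]]] := charsimple_dprod (minnormal_charsimple minM).
have [f If not_sfSH]: exists2 f, f \in I & ~~ (f @: S \subset H).
  apply/exists_inP; apply: contraR not_sMH; rewrite negb_exists_in => /forall_inP sIH.
  rewrite -(bigdprodWY defM) gen_subG; apply/bigcupsP=> f /sIH.
  by rewrite negbK.
have Af := subsetP sIA f If; pose T := (autm Af @* S)%G.
have defT: T = f @: S :> {set gT} by rewrite /= morphimEsub.
have isoT: S \isog T by rewrite sub_isog ?injm_autm.
have [B cTB defTB]: exists2 B : {group gT}, B \subset 'C(T) & T * B = M.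
  move: defM; rewrite (bigD1 f) //= -defT => /dprodP[[_ B _ ->] defTB cTB _].
  by exists B.
have sBM: B \subset M by rewrite -defTB mulG_subr.
have sTM: T \subset M by rewrite -defTB mulG_subl.
exists T; split; rewrite -?(isog_simple isoT) ?defT //.
  (* An abelian [T] would be central in [M]; the centre, being characteristic and nontrivial, would
     be all of [M] by minimality. *)
  rewrite -defT; apply: contra nabM => cTT; have nt_T: T :!=: 1.
    by have /simpleP[] : simple T by rewrite -(isog_simple isoT).
  have sTZ: T \subset 'Z(M).
    by rewrite subsetI sTM -defTB centM subsetI (cTT : T \subset 'C(T)) centsC.
  have /mingroupP[/andP[_ nMG] minM'] := minM.
  apply/center_idP/minM'; rewrite ?center_sub //.
  rewrite (char_norm_trans (center_char M)) // andbT.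
  by apply: contraNneq nt_T => Z1; rewrite -subG1 -Z1.
rewrite -defT; apply/eqP; rewrite eqEsubset mul_subG ?subsetIl //=.
by rewrite -{1}defTB mulgS // subsetI sBM.
Qed.

Definition minimal_normal G M := [min M of H | (H :!=: 1) && (H <| G)].

Lemma minimal_normal_sub_socle G M : minimal_normal G M -> M \subset socle G.
Proof. by move=> minM; rewrite bigprodGE sub_gen // (bigcup_sup M). Qed.

Lemma socle_subP G (A : {group gT}) :
  reflect (forall M, minimal_normal G M -> M \subset A) (socle G \subset A).
Proof. by rewrite bigprodGE gen_subG; apply: (iffP bigcupsP). Qed.

(** [minnormal] only asks that [G] normalise the subgroup, but any competitor inside [M] lies in [G]
    anyway. *)
Lemma minimal_normalW G M : minimal_normal G M -> minnormal M G /\ M <| G.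
Proof.
case/mingroupP=> /andP[ntM nsMG] minM; split=> //.
apply/mingroupP; rewrite ntM normal_norm //; split=> // K /andP[ntK nKG] sKM.
by apply: minM; rewrite // ntK /normal nKG (subset_trans sKM (normal_sub nsMG)).
Qed.

(** The commutator lies in [M1 :&: M2], which is trivial by minimality. *)
Lemma minimal_normal_cents G M1 M2 :
    minimal_normal G M1 -> minimal_normal G M2 -> M1 :!=: M2 ->
  M1 \subset 'C(M2).
Proof.
move=> min1 min2 neqM; apply/commG1P/trivgP.
have [/andP[_ ns1] /(_ (M1 :&: M2)%G) minI1] := mingroupP min1.
have [/andP[_ ns2] /(_ (M1 :&: M2)%G) minI2] := mingroupP min2.
have TI: M1 :&: M2 = 1.
  apply: contraNeq neqM => ntI; have nsI := normalI ns1 ns2.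
  by rewrite -[X in X == _]minI1 ?subsetIl ?ntI // minI2 ?subsetIr ?ntI.
rewrite -TI subsetI commg_subl commg_subr.
rewrite (subset_trans (normal_sub ns1) (normal_norm ns2)).
by rewrite (subset_trans (normal_sub ns2) (normal_norm ns1)).
Qed.

End Socle.

(** * Derangements of transitive permutation groups *)

Section Permutations.

Variable Omega : finType.
Implicit Types G M N : {group {perm Omega}}.

(** If [x] fixes the image of [w] under [y], then [x ^ y^-1] fixes [w]; by transitivity every point
    is such an image. *)
Lemma coset_derangements_stab N w :
    [transitive N, on [set: Omega] | 'P] ->
  coset_derangements N 'C_N[w | 'P] \subset derangements N.
Proof.
move=> trN; apply/subsetP=> x /coset_derangementsP[Nx dx].
rewrite inE Nx; apply/forallP=> u.
have [y Ny ->] := atransP2 trN (in_setT w) (in_setT u).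
have:= dx y^-1 (groupVr Ny); apply: contra => /eqP xwy.
rewrite inE groupJ ?groupV //; apply/astab1P.
by rewrite conjgE invgK !actM /= [aperm _ x]xwy -actM mulgV act1.
Qed.

(** An element commuting with the transitive [M] and fixing one point fixes all of them. As [N] has
    more than two elements, some [a] differs from [1] and [x], and [x] is [a * (a^-1 * x)]. *)
Lemma cent_transitive_derangements N M :
    [transitive M, on [set: Omega] | 'P] -> M \subset N -> N \subset 'C(M) ->
    2 < #|Omega| ->
  N \subset derangements N * derangements N.
Proof.
move=> trM sMN cMN gt2; have DN x : x \in N -> x != 1 -> x \in derangements N.
  move=> Nx nt_x; rewrite inE Nx; apply/forallP=> w; apply: contra nt_x => /eqP xw.
  apply/eqP/permP=> u; rewrite perm1.
  have [y My ->] := atransP2 trM (in_setT w) (in_setT u).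
  by rewrite /= apermE -permM -(centP (subsetP cMN x Nx)) // permM xw.
have gt2N: 2 < #|N|.
  have /imsetP[w _ defO] := trM.
  apply: leq_trans gt2 (leq_trans _ (subset_leq_card sMN)).
  by rewrite -cardsT defO leq_imset_card.
apply/subsetP=> x Nx; have: ~~ (N \subset [set 1; x]).
  apply: contraL gt2N => /subset_leq_card leN; rewrite -leqNgt.
  by apply: leq_trans leN _; rewrite cards2; case: (1 != x).
case/subsetPn=> a Na; rewrite !inE negb_or => /andP[nt_a neq_ax].
apply/mulsgP; exists a (a^-1 * x); rewrite ?DN ?mulKVg ?groupM ?groupV //.
by rewrite -eq_mulVg1.
Qed.

End Permutations.

(** * The socle of a primitive group *)

Theorem theorem6
  (LST : forall (Gamma : finType) (T : {group {perm Gamma}}),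
     1 < #|Gamma| -> simple T -> ~~ abelian T ->
     [transitive T, on [set: Gamma] | 'P] ->
     T :=: derangements T * derangements T)
  (Omega : finType) (G : {group {perm Omega}})
  (primG : [primitive G, on [set: Omega] | 'P])
  (cardOmega : 3 <= #|Omega|) :
  socle G :=: derangements (socle G) * derangements (socle G).
Proof.
set N := socle G.
have sDN: derangements N \subset N by apply/subsetP=> x; rewrite inE => /andP[].
apply/eqP; rewrite eqEsubset andbC (subset_trans (mulgSS sDN sDN)) ?mulGid //=.
(* By primitivity a normal subgroup is transitive or fixes every point, and the latter makes it
   trivial. *)
have trM M : minimal_normal G M -> [transitive M, on [set: Omega] | 'P].
  move=> minM; have [_ nsMG] := minimal_normalW minM.
  have [cM | //] := prim_trans_norm primG nsMG.
  have /andP[/eqP ntM _] := mingroupp minM; case: ntM.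
  apply/trivgP; apply: subset_trans cM _; apply/subsetP=> x /setIP[_ /astabP fx].
  by rewrite inE; apply/eqP/permP=> w; rewrite perm1 -[RHS](fx w) ?inE.
have trG : [transitive G, on [set: Omega] | 'P] by case/andP: primG.
have ntG: G :!=: 1.
  apply: contraTneq trG => G1; apply/imsetP=> -[w _ defO].
  have: #|[set: Omega]| <= #|G| by rewrite defO leq_imset_card.
  by rewrite cardsT G1 cards1 leqNgt (ltn_trans _ cardOmega).
have [M0 minM0 _]:
    {M0 : {group {perm Omega}} | minimal_normal G M0 & M0 \subset G}.
  by apply: mingroup_exists; rewrite ntG normal_refl.
have sMN M : minimal_normal G M -> M \subset N.
  exact: minimal_normal_sub_socle.
have centM M M' : minimal_normal G M -> minimal_normal G M' -> M :!=: M' ->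
    M' \subset 'C(M).
  move=> minM minM' neM; apply: minimal_normal_cents minM' minM _.
  by rewrite eq_sym.
have trN: [transitive N, on [set: Omega] | 'P].
  rewrite (atrans_supgroup (sMN M0 minM0) (trM M0 minM0)).
  by apply/actsP=> x _ w; rewrite !inE.
have [[M /andP[minM abM]] | nabM] :
    (exists M : {group {perm Omega}}, minimal_normal G M && abelian M) \/
    forall M, minimal_normal G M -> ~~ abelian M.
  have [/existsP | /existsPn nabM] := boolP
      [exists M : {group {perm Omega}}, minimal_normal G M && abelian M].
    by left.
  by right=> M minM; have := nabM M; rewrite minM.
(* The abelian [M] is centralised by itself and by every other minimal normal subgroup, hence by
   [N]. *)
- apply: (cent_transitive_derangements (trM M minM)); rewrite ?sMN //.
  apply/socle_subP=> M' minM'.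
  by have [<- // | /centM->] := eqVneq (gval M) (gval M').
have [w _ defO] := imsetP trN.
have ltSN: 'C_N[w | 'P] \proper N.
  rewrite properEneq subsetIl andbT; apply: contraTneq cardOmega => defS.
  by rewrite -cardsT defO card_orbit defS indexgg.
have [/eqP | [H maxH sSH]] := maximal_exists (proper_sub ltSN).
  by rewrite eqEsubset => /andP[_]; rewrite (negbTE (proper_subn ltSN)).
(* Enlarging the stabiliser to [H] only shrinks the set of coset derangements. *)
have sDH := subset_trans (coset_derangementsS _ sSH)
  (coset_derangements_stab w trN).
apply: subset_trans (mulgSS sDH sDH).
have [M minM not_sMH]: exists2 M : {group {perm Omega}},
    minimal_normal G M & ~~ (M \subset H).
  have /andP[_ not_sNH] := maxgroupp maxH.
  apply/exists_inP; apply: contraR not_sNH.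
  rewrite negb_exists_in => /forall_inP sMH.
  by apply/socle_subP=> M /sMH; rewrite negbK.
have [minnM _] := minimal_normalW minM.
have [T [simT nabT not_sTH defM]] :=
  minnormal_simple_factor minnM (nabM M minM) not_sMH.
have sTM: T \subset M by rewrite -defM mulG_subl.
(* It suffices to place each minimal normal subgroup in the product: [M] is [T * 'C_M(T)], and the
   others centralise [M], hence [T]. *)
have defN: T \* 'C_N(T) = N.
  rewrite cprodE ?subsetIr //; apply/eqP.
  rewrite eqEsubset mul_subG ?subsetIl ?(subset_trans sTM) ?sMN //=.
  rewrite -cent_joinEr ?subsetIr //; apply/socle_subP=> M' minM'.
  rewrite /= cent_joinEr ?subsetIr //.
  have [<- | /(centM _ _ minM minM') cMM'] := eqVneq (gval M) (gval M').
    by rewrite -defM mulgS // setSI ?sMN.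
  apply: subset_trans (mulG_subr T _).
  by rewrite subsetI sMN // (subset_trans cMM') // centS.
have [sCH | not_sCH] := boolP ('C_N(T) \subset H).
  exact: coset_derangements_factor_sub LST simT nabT defN not_sTH sCH.
exact: coset_derangements_factor_notsub simT nabT defN maxH not_sTH not_sCH.
Qed.
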